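(* Let $\rho > 0$, $D\subseteq\mathbb{F}_q$, $d=\rho|D|$, and let $V=\mathsf{RS}[\mathbb{F}_q,D,d]$ be the set of functions $D\to\mathbb{F}_q$ whose interpolating polynomial has degree $<d$. For $z,b \in \mathbb{F}_q$ let $V_{z,b} = \{ Q(Y) \in V \mid Q(z) = b \}$. For $\alpha < 1$ let $L^* = \mathcal{L}(\mathbb{F}_q, D, d, 1-\alpha)$. Let $\eta\in[0,1]^D$ be a weight vector, let $\epsilon>0$, let $u,u^* \in \mathbb{F}_q^D$, and for each $z\in \mathbb{F}_q$ let $B_z(X) \in \mathbb{F}_q[X]$ be an arbitrary linear polynomial. Suppose that $$\Pr_{x, z \in \mathbb{F}_q} [ \mathrm{agree}_{\eta}( u^* + x u, V_{z, B_z(x)}) > \alpha] \geq \max\left(2L^* \left( \frac{d}{q} + \epsilon\right)^{1/3} , \frac{4}{\epsilon^2 q} \right)$$ with $x,z$ independent and uniform. Then there exist $v, v^*\in V$ and $C \subseteq D$ such that $\sum_{y \in C} \eta(y) > (\alpha - \epsilon) |D|$, $u|_{C}=v|_{C}$ and $u^*|_{C}=v^*|_{C}$. Consequently $\mathrm{agree}_\eta(u, V), \mathrm{agree}_\eta(u^*, V) \geq \alpha - \epsilon$.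
   Context: For $u,v\in\mathbb{F}_q^D$ and $\eta\in[0,1]^D$, $\mathrm{agree}_\eta(u,v)=\frac{1}{|D|}\sum_{i\in D:\,u_i=v_i}\eta(i)$, and for a set $W$, $\mathrm{agree}_\eta(u,W)=\max_{w\in W}\mathrm{agree}_\eta(u,w)$. $\Delta$ is relative Hamming distance. For $V'\subseteq\mathbb{F}_q^D$, $\mathrm{List}(u,V',\delta)=\{v\in V':\Delta(u,v)<\delta\}$, and $\mathcal{L}(\mathbb{F}_q,D,d,\delta)$ is the maximum of $|\mathrm{List}(u,V',\delta)|$ over $u\in\mathbb{F}_q^D$ where $V'$ is the set of functions $D\to\mathbb{F}_q$ with interpolating polynomial of degree $<d$. *)

(* Defs.v *)
From HB Require Import structures.
From mathcomp Require Import all_boot all_order all_algebra.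
From mathcomp Require Import reals exp.

Set Implicit Arguments.
Unset Strict Implicit.
Unset Printing Implicit Defensive.

Import Order.TTheory GRing.Theory Num.Theory.

Local Open Scope ring_scope.

(* F^D, indexed by the subtype of the elements of D so that a word carries no
   values outside D. *)
Notation word F D := {ffun {y : F | y \in D} -> F}.

Definition agree (R : realType) (F : finFieldType) (D : {set F})
    (eta : {y : F | y \in D} -> R) (u v : word F D) : R :=
  #|D|%:R^-1 * \sum_(i | u i == v i) eta i.

(* As agree eta u w >= 0 for nonnegative eta, the neutral element 0 does not
   affect the maximum when W is nonempty. *)
Definition agree_set (R : realType) (F : finFieldType) (D : {set F})
    (eta : {y : F | y \in D} -> R) (u : word F D) (W : {set word F D}) : R :=
  \big[Num.max/0]_(w in W) agree eta u w.

Definition hamming (R : realType) (F : finFieldType) (D : {set F})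
    (u v : word F D) : R :=
  #|[set i | u i != v i]|%:R / #|D|%:R.

(* Lagrange's formula; interp_horner, size_interp and interp_unique
   characterize it as the polynomial of degree < #|D| extending f. *)
Definition interp (F : finFieldType) (D : {set F}) (f : word F D) : {poly F} :=
  \sum_i f i *: \prod_(j | j != i) ((val i - val j)^-1 *: ('X - (val j)%:P)).

Lemma interp_horner (F : finFieldType) (D : {set F}) (f : word F D) i :
  (interp f).[val i] = f i.
Proof.
rewrite /interp horner_sum (bigD1 i) //= [X in _ + X]big1 => [|k nki].
  rewrite addr0 hornerZ horner_prod big1 ?mulr1 // => j nji.
  by rewrite hornerZ hornerXsubC mulVf // subr_eq0 (inj_eq val_inj) eq_sym.
rewrite hornerZ horner_prod (bigD1 i) 1?eq_sym //=.
by rewrite hornerZ hornerXsubC subrr !(mulr0, mul0r).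
Qed.

Lemma size_interp (F : finFieldType) (D : {set F}) (f : word F D) :
  (size (interp f) <= #|D|)%N.
Proof.
apply: leq_trans (size_sum _ _ _) _; apply/bigmax_leqP => i _.
apply: leq_trans (size_scale_leq _ _) _; rewrite scaler_prod.
apply: leq_trans (size_scale_leq _ _) _.
apply: leq_trans (size_poly_prod_leq _ _) _.
under eq_bigr => j _ do rewrite size_XsubC.
rewrite sum_nat_const.
have <- : #|{: {y | y \in D}}| = #|D| by rewrite card_sig.
rewrite -[#|{: _}|](cardC (pred1 i)) card1 add1n.
by rewrite muln2 -addnn -addSn addnK.
Qed.

Lemma interp_unique (F : finFieldType) (D : {set F}) (f : word F D)
    (p : {poly F}) :
  (size p <= #|D|)%N -> (forall i, p.[val i] = f i) -> p = interp f.
Proof.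
move=> sp pf; apply/eqP; rewrite -subr_eq0; apply/eqP.
apply: (@roots_geq_poly_eq0 _ _ (enum D)); last 2 first.
- exact: enum_uniq.
- rewrite -cardE; apply: leq_trans (size_polyD _ _) _.
  by rewrite size_polyN geq_max sp size_interp.
apply/allP => y; rewrite mem_enum => yD.
rewrite /root !hornerE (pf (Sub y yD)).
rewrite -[X in (interp f).[X]]/(val (Sub y yD : {y | y \in D})).
by rewrite interp_horner subrr.
Qed.

(* Degree < d is size <= d, the zero polynomial included. *)
Definition RS (F : finFieldType) (D : {set F}) (d : nat) : {set word F D} :=
  [set f | (size (interp f) <= d)%N].

Definition RS_at (F : finFieldType) (D : {set F}) (d : nat) (z b : F) :
    {set word F D} :=
  [set f in RS D d | (interp f).[z] == b].

Definition ListDec (R : realType) (F : finFieldType) (D : {set F})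
    (u : word F D) (V : {set word F D}) (delta : R) : {set word F D} :=
  [set v in V | hamming R u v < delta].

Definition RS_list_size (R : realType) (F : finFieldType) (D : {set F})
    (d : nat) (delta : R) : nat :=
  \max_(u : word F D) #|ListDec u (RS D d) delta|.

Definition uniform_prob (R : realType) (T : finType) (P : pred T) : R :=
  #|P|%:R / #|T|%:R.

(* Main.v *)
Require Import Defs.
From HB Require Import structures.
From mathcomp Require Import all_boot all_order all_algebra.
From mathcomp Require Import reals exp ring lra.

Set Implicit Arguments.
Unset Strict Implicit.
Unset Printing Implicit Defensive.

Import Order.TTheory GRing.Theory Num.Theory.

Local Open Scope ring_scope.

(* For a set A of at least 2 / eps^2 scalars x, the pigeonhole principle over
   the list of codewords agreeing with ustar + x u gives one codeword v_x with
   v_x(z) = B_z(x) for many z.  By Jensen, for a random triple (x, y, w) in A^3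
   the three equalities hold simultaneously for a fraction at least d/q + eps
   of the z's; as B_z is linear, d such z's force the points (x, v_x),
   (y, v_y), (w, v_w) to be collinear.  Hence some pair x <> y is collinear
   with at least 1 / eps scalars w, and the line vstar + w v through it
   agrees with ustar + w u at all of them, which leaves weight at most
   eps |D| to the agreements outside C. *)

(** * Counting and averaging *)

Lemma card_setE (R : numDomainType) (T : finType) (A : {set T}) (P : pred T) :
  #|[set x in A | P x]|%:R = \sum_(x in A) (P x)%:R :> R.
Proof.
rewrite -sum1dep_card natr_sum big_mkcondr /=.
by apply: eq_bigr => x _; case: (P x).
Qed.

Lemma card_predE (R : numDomainType) (T : finType) (P : pred T) :
  #|[set x | P x]|%:R = \sum_x (P x)%:R :> R.
Proof.
rewrite -sum1dep_card natr_sum big_mkcond /=.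
by apply: eq_bigr => x _; case: (P x).
Qed.

(** A reverse Markov inequality: points below the threshold contribute at most [c] each, the others
    at most [M]. A large mean therefore forces many points above the threshold. *)
Lemma sum_le_threshold (R : realDomainType) (T : finType) (f : T -> R) (M c : R) :
    (forall x, f x <= M) -> 0 <= c ->
  \sum_x f x <= M * #|[set x | c <= f x]|%:R + c * #|T|%:R.
Proof.
move=> fM c0; rewrite card_predE mulr_sumr (mulr_natr c) -sumr_const -big_split /=.
apply: ler_sum => x _; case: (lerP c (f x)) => h; last by rewrite mulr0 add0r ltW.
by rewrite mulr1 (le_trans (fM x)) // lerDl.
Qed.

(* Jensen's inequality for t^3, through the tangent-line bound
   t^3 >= 3 m^2 t - 2 m^3 at m = tau * #|A|. *)
Lemma sum_card_triples_ge (R : realFieldType) (X Z : finType) (A : {set X})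
    (h : X -> Z -> bool) (tau : R) :
    0 <= tau ->
    {in A, forall x, tau * #|Z|%:R <= #|[set z | h x z]|%:R} ->
  #|A|%:R ^+ 3 * (tau ^+ 3 * #|Z|%:R) <=
  \sum_(x in A) \sum_(y in A) \sum_(w in A)
    #|[set z | [&& h x z, h y z & h w z]]|%:R.
Proof.
move=> tau0 hA; pose a z : R := \sum_(x in A) (h x z)%:R.
have a0 z : 0 <= a z by apply: sumr_ge0 => x _; apply: ler0n.
have sum_a : #|A|%:R * (tau * #|Z|%:R) <= \sum_z a z.
  rewrite exchange_big /= mulr_natl -sumr_const.
  by apply: ler_sum => x xA; rewrite -card_predE hA.
(* For fixed [z], the triples for which [h] holds three times at [z] number [a z ^+ 3]. *)
have -> : \sum_(x in A) \sum_(y in A) \sum_(w in A)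
    #|[set z | [&& h x z, h y z & h w z]]|%:R = \sum_z a z ^+ 3.
  under [LHS]eq_bigr => x _.
    under eq_bigr => y _.
      under eq_bigr => w _ do rewrite card_predE.
      rewrite exchange_big; over.
    rewrite exchange_big; over.
  rewrite exchange_big; apply: eq_bigr => z _ /=.
  transitivity (a z * (a z * a z)); last by rewrite !exprS expr0 mulr1.
  rewrite /a mulr_suml; apply: eq_bigr => x _.
  rewrite mulrA [X in X * _]mulr_sumr mulr_suml; apply: eq_bigr => y _.
  rewrite mulr_sumr; apply: eq_bigr => w _.
  by rewrite -!natrM !mulnb andbA.
pose m : R := tau * #|A|%:R.
have m0 : 0 <= m by rewrite mulr_ge0.
have tangent z : 3 * m ^+ 2 * a z - 2 * m ^+ 3 <= a z ^+ 3.
  rewrite -subr_ge0.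
  have -> : a z ^+ 3 - (3 * m ^+ 2 * a z - 2 * m ^+ 3)
    = (a z - m) ^+ 2 * (a z + 2 * m) by ring.
  by rewrite mulr_ge0 ?sqr_ge0 // addr_ge0 // mulr_ge0.
apply: le_trans (ler_sum _ (fun z _ => tangent z)).
(* By [sum_a] the [a z] sum to at least [m * #|Z|], so the tangent bounds sum to at least
   [(3 m^3 - 2 m^3) #|Z| = m^3 #|Z|]. *)
rewrite sumrB sumr_const -mulr_sumr -(mulr_natr (2 * _)).
have := ler_wpM2l (mulr_ge0 (ler0n R 3) (sqr_ge0 m)) sum_a.
set S := \sum_z _; rewrite /m => H; apply: le_trans (lerB H (lexx _)).
by rewrite le_eqVlt; apply/orP; left; apply/eqP; ring.
Qed.

(** By contradiction. If every off-diagonal pair has fewer than [1/eps] partners [w], at most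
    [a^2/eps + a^2] triples satisfy [P]. Those have at most [q] common [z], all others at most [d].
    Against the Jensen bound [a^3 (d + eps q)] this gives [eps a <= 1/eps + 1], whereas
    [a >= 2/eps^2] gives [eps a >= 2/eps]; hence [1/eps <= 1]. *)
Lemma exists_rich_pair (R : realFieldType) (X Z : finType) (A : {set X})
    (h : X -> Z -> bool) (P : X -> X -> pred X) (d : nat) (tau eps : R) :
    0 <= tau -> 0 < eps < 1 -> (0 < #|Z|)%N ->
    d%:R + eps * #|Z|%:R <= tau ^+ 3 * #|Z|%:R ->
    2 / eps ^+ 2 <= #|A|%:R ->
    {in A, forall x, tau * #|Z|%:R <= #|[set z | h x z]|%:R} ->
    (forall x y w, x \in A -> y \in A -> w \in A ->
      (d <= #|[set z | [&& h x z, h y z & h w z]]|)%N -> P x y w) ->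
  exists x y, [/\ x \in A, y \in A, x != y & eps^-1 <= #|[set w in A | P x y w]|%:R].
Proof.
move=> tau0 /andP[e0 e1] Z0 tauE bigA hA hP.
set a : R := #|A|%:R in bigA *; set q : R := #|Z|%:R in tauE hA *.
have q0 : 0 < q by rewrite ltr0n.
have a0 : 0 < a by apply: lt_le_trans bigA; rewrite divr_gt0 ?exprn_gt0.
pose n x y : R := #|[set w in A | P x y w]|%:R.
case: (boolP [exists x in A, [exists y in A, (x != y) && (eps^-1 <= n x y)]]).
  move=> /exists_inP[x xA /exists_inP[y yA /andP[nxy nP]]].
  by exists x, y; split.
move=> /exists_inPn none; exfalso.
(* On the diagonal only the trivial bound [#|A|] is available: two equal points are collinear with
   any third. *)
have n_le x y : x \in A -> y \in A -> n x y <= eps^-1 + a * (x == y)%:R.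
  move=> xA yA; have [<-|nxy] := eqVneq x y.
    rewrite mulr1 -[leLHS]add0r lerD ?invr_ge0 ?(ltW e0) // ler_nat.
    by apply: subset_leq_card; apply/subsetP => w; rewrite inE => /andP[].
  rewrite mulr0 addr0; have /exists_inPn/(_ _ yA) := none _ xA.
  by rewrite nxy /= -ltNge => /ltW.
have sum_n : \sum_(x in A) \sum_(y in A) n x y <= a ^+ 2 * eps^-1 + a ^+ 2.
  have -> : a ^+ 2 * eps^-1 + a ^+ 2 =
    \sum_(x in A) \sum_(y in A) (eps^-1 + a * (x == y)%:R).
    transitivity (\sum_(x in A) (a * eps^-1 + a)).
      by rewrite sumr_const -mulr_natl -/a; ring.
    apply: eq_bigr => x xA; rewrite big_split /= sumr_const -mulr_natl.
    congr (_ + _); rewrite (bigD1 x) //= eqxx mulr1 big1 ?addr0 // => y /andP[_ nyx].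
    by rewrite eq_sym (negPf nyx) mulr0.
  by apply: ler_sum => x xA; apply: ler_sum => y yA; exact: n_le.
have key : a ^+ 3 * (tau ^+ 3 * q) <= a ^+ 3 * d%:R + q * (a ^+ 2 * eps^-1 + a ^+ 2).
  apply: le_trans (sum_card_triples_ge tau0 hA) _.
  apply: le_trans (lerD (lexx _) (ler_wpM2l (ltW q0) sum_n)).
  have -> : a ^+ 3 * d%:R = \sum_(x in A) \sum_(y in A) \sum_(w in A) d%:R.
    rewrite !sumr_const -!mulrnA -[RHS]mulr_natl !natrM -/a; ring.
  rewrite mulr_sumr -big_split; apply: ler_sum => x xA /=.
  rewrite mulr_sumr -big_split; apply: ler_sum => y yA /=.
  rewrite /n card_setE mulr_sumr -big_split; apply: ler_sum => w wA /=.
  case: leqP (hP x y w xA yA wA) => [_ /(_ isT) ->|/ltnW lt_d _].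
    by rewrite mulr1 -[leLHS]add0r lerD // ler_nat max_card.
  by rewrite -[leLHS]addr0 lerD ?ler_nat // mulr_ge0 // ltW.
have {}key := le_trans (ler_wpM2l (exprn_ge0 3 (ltW a0)) tauE) key.
have key2 : eps * a <= eps^-1 + 1.
  rewrite -(ler_pM2l (mulr_gt0 q0 (exprn_gt0 2 a0))).
  have -> : q * a ^+ 2 * (eps * a) =
    a ^+ 3 * (d%:R + eps * q) - a ^+ 3 * d%:R by ring.
  by rewrite lerBlDl (le_trans key) // lerD2l; lra.
have := ler_wpM2l (ltW e0) bigA.
have -> : eps * (2 / eps ^+ 2) = eps^-1 + eps^-1 by field; rewrite gt_eqF.
move=> /le_trans/(_ key2); rewrite lerD2l => h1.
have := invf_gt1 e0; rewrite e1 => /idP; lra.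
Qed.

(** * Codewords, weighted agreement and collinearity *)

Lemma interp_linear (F : finFieldType) (D : {set F}) (f g : word F D) (a b : F) :
  interp [ffun i => a * f i + b * g i] = a *: interp f + b *: interp g.
Proof.
rewrite /interp !scaler_sumr -big_split; apply: eq_bigr => i _ /=.
by rewrite ffunE scalerDl !scalerA.
Qed.

Lemma RS_linear (F : finFieldType) (D : {set F}) (d : nat) (f g : word F D) (a b : F) :
  f \in RS D d -> g \in RS D d -> [ffun i => a * f i + b * g i] \in RS D d.
Proof.
rewrite !inE interp_linear => sf sg; apply: leq_trans (size_polyD _ _) _.
by rewrite geq_max !(leq_trans (size_scale_leq _ _)).
Qed.

Lemma agree_set_le (R : realType) (F : finFieldType) (D : {set F})
    (eta : {y : F | y \in D} -> R) (u w : word F D) (W : {set word F D}) :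
  w \in W -> agree eta u w <= agree_set eta u W.
Proof. exact: (@le_bigmax_cond _ R _ 0 w (mem W)). Qed.

Lemma card_coord (F : finFieldType) (D : {set F}) : #|{: {y : F | y \in D}}| = #|D|.
Proof. by rewrite card_sig. Qed.

(** As weights are at most 1, weighted agreement is at most [1 - hamming]. This places the codewords
    of large agreement in the list counted by [RS_list_size]. *)
Lemma hamming_lt (R : realType) (F : finFieldType) (D : {set F}) (D0 : D != set0)
    (eta : {y : F | y \in D} -> R) (eta1 : forall y, eta y <= 1)
    (alpha : R) (u v : word F D) :
  alpha < agree eta u v -> hamming R u v < 1 - alpha.
Proof.
move=> lt_agree; have cD : 0 < #|D|%:R :> R by rewrite ltr0n card_gt0.
rewrite ltrBrDl -ltrBrDr; apply: lt_le_trans lt_agree _.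
rewrite /agree /hamming -(ler_pM2l cD) mulrA divff ?gt_eqF // mul1r.
rewrite mulrBr mulr1 mulrCA divff ?gt_eqF // mulr1 card_predE.
rewrite -[X in X%:R - _]card_coord -sum1_card natr_sum -sumrB big_mkcond.
apply: ler_sum => i _; case: (u i == v i) => /=; last by rewrite subrr.
by rewrite subr0.
Qed.

(** The coefficients [y - w], [w - x], [x - y] annihilate the values at [x], [y], [w] of any affine
    function, in particular of [B z]. So each common [z] is a root of the same combination of the
    interpolants, which has size at most [d] and hence vanishes. *)
Lemma collinear_codewords (F : finFieldType) (D : {set F}) (d : nat)
    (B : F -> {poly F}) (B_linear : forall z, (size (B z) <= 2)%N)
    (fx fy fw : word F D) (x y w : F) :
    fx \in RS D d -> fy \in RS D d -> fw \in RS D d ->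
    (d <= #|[set z | [&& (interp fx).[z] == (B z).[x],
       (interp fy).[z] == (B z).[y] & (interp fw).[z] == (B z).[w]]]|)%N ->
  forall i, (y - w) * fx i + (w - x) * fy i + (x - y) * fw i = 0.
Proof.
rewrite !inE => sx sy sw dle.
pose p := (y - w) *: interp fx + (w - x) *: interp fy + (x - y) *: interp fw.
have p0 : p = 0.
  apply: (@roots_geq_poly_eq0 _ _ (enum [set z | [&& (interp fx).[z] == (B z).[x],
       (interp fy).[z] == (B z).[y] & (interp fw).[z] == (B z).[w]]])).
  - apply/allP => z; rewrite mem_enum inE => /and3P[/eqP hx /eqP hy /eqP hw].
    rewrite /root /p !hornerD !hornerZ hx hy hw.
    have BE t : (B z).[t] = (B z)`_0 + (B z)`_1 * t.
      by rewrite (horner_coef_wide _ (B_linear z)) big_ord_recl big_ord1 expr0 mulr1 expr1.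
    by apply/eqP; rewrite !BE; ring.
  - exact: enum_uniq.
  - rewrite -cardE; apply: leq_trans dle.
    rewrite !(leq_trans (size_polyD _ _)) // geq_max.
    rewrite (leq_trans (size_scale_leq _ _)) // andbT.
    rewrite (leq_trans (size_polyD _ _)) // geq_max.
    by rewrite !(leq_trans (size_scale_leq _ _)).
by move=> i; have := congr1 (fun p => p.[val i]) p0; rewrite /p !hornerE !interp_horner.
Qed.

(* At a coordinate outside C the affine functions w |-> ustar + w u and
   w |-> vstar + w v are distinct, hence meet for at most one w. *)
Lemma weight_common_agreement (R : realType) (F : finFieldType) (D : {set F})
    (D0 : D != set0)
    (eta : {y : F | y \in D} -> R) (eta01 : forall y, 0 <= eta y <= 1)
    (alpha eps : R) (u ustar v vstar : word F D) (A : {set F}) :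
    0 < eps -> eps^-1 <= #|A|%:R ->
    {in A, forall w, alpha < agree eta [ffun y => ustar y + w * u y]
                                       [ffun y => vstar y + w * v y]} ->
  (alpha - eps) * #|D|%:R <
    \sum_(y in [set y | (u y == v y) && (ustar y == vstar y)]) eta y.
Proof.
move=> e0 bigA hA; set C := [set y | _].
have cD : 0 < #|D|%:R :> R by rewrite ltr0n card_gt0.
set a : R := #|A|%:R in bigA *.
have a0 : 0 < a by apply: lt_le_trans bigA; rewrite invr_gt0.
have A0 : has (mem A) (index_enum F).
  have /card_gt0P[x xA] : (0 < #|A|)%N by rewrite -(ltr0n R).
  by apply/hasP; exists x; rewrite ?mem_index_enum.
have lower : a * (alpha * #|D|%:R) <
    \sum_(w in A) \sum_(y | ustar y + w * u y == vstar y + w * v y) eta y.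
  rewrite mulr_natl -sumr_const; apply: ltr_sum => // w /hA.
  rewrite /agree [X in _ < X -> _]mulrC ltr_pdivlMr //.
  by under eq_bigl => y do rewrite !ffunE.
(* Double counting by coordinates: one in [C] is counted at most [#|A|] times, any other at most
   once and with weight at most 1. *)
have upper : \sum_(w in A) \sum_(y | ustar y + w * u y == vstar y + w * v y) eta y
    <= a * (\sum_(y in C) eta y) + #|D|%:R.
  under eq_bigr => w _ do rewrite big_mkcond.
  rewrite exchange_big /= mulr_sumr -[X in _ + X%:R]card_coord -sum1_card natr_sum.
  rewrite [X in _ <= X + _]big_mkcond /= -big_split /=; apply: ler_sum => y _.
  have /andP[ey0 ey1] := eta01 y.
  case: ifPn => yC.
    apply: (@le_trans _ _ (\sum_(w in A) eta y)).
      by apply: ler_sum => w _; case: ifP.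
    by rewrite sumr_const -[leLHS]mulr_natl lerDl.
  rewrite add0r -big_mkcondr /=.
  case: (pickP [pred w | (w \in A) && (ustar y + w * u y == vstar y + w * v y)]) => [w0|none]; last first.
    by rewrite big_pred0.
  move=> /= /[dup] w0P /andP[w0A /eqP w0E].
  rewrite (bigD1 w0) //= big1 ?addr0 // => w /andP[/andP[wA /eqP wE] nw].
  (* A second meeting point [w] would give [u y = v y], then [ustar y = vstar y], putting [y] in
     [C]. *)
  have uv : u y = v y.
    apply: (@mulfI _ (w - w0)); first by rewrite subr_eq0.
    apply: (@addIr _ (ustar y + w0 * u y)); rewrite [in RHS]w0E.
    transitivity (ustar y + w * u y); first by ring.
    by rewrite wE; ring.
  move: yC; rewrite inE uv eqxx /=; move: w0E; rewrite uv => /addIr ->.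
  by rewrite eqxx.
have {lower upper} key := lt_le_trans lower upper.
rewrite -(ltr_pM2l a0) mulrBl mulrBr ltrBlDr; apply: lt_le_trans key _.
rewrite lerD2l mulrA ler_peMl ?(ltW cD) //.
by have := ler_wpM2r (ltW e0) bigA; rewrite mulVf ?gt_eqF.
Qed.

(* alpha >= 0 is essential: agree_set is 0 on an empty W. *)
Lemma exists_popular_codeword (R : realType) (F : finFieldType) (D : {set F}) (d : nat)
    (alpha : R) (alpha_ge0 : 0 <= alpha)
    (eta : {y : F | y \in D} -> R) (w : word F D) (b : F -> F) (L : nat) (tau : R) :
    (#|[set v in RS D d | (alpha < agree eta w v)%R]| <= L)%N ->
    0 < tau ->
    0 < #|[set z | alpha < agree_set eta w (RS_at D d z (b z))]|%:R :> R ->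
    L%:R * tau <= #|[set z | alpha < agree_set eta w (RS_at D d z (b z))]|%:R ->
  exists v, [/\ v \in RS D d, alpha < agree eta w v
              & tau <= #|[set z | (interp v).[z] == b z]|%:R].
Proof.
set S := [set v in RS D d | _]; set E := [set z | _] => SL tau0 E0 LE.
case: (pickP [pred v in S | tau <= #|[set z | (interp v).[z] == b z]|%:R]).
  by move=> v /andP[]; rewrite inE => /andP[vR vagree] vtau; exists v.
move=> none; exfalso.
(* Each [z] in [E] is witnessed by a codeword that agrees well with [w], that is, one in [S]. *)
have cover : #|E|%:R <= \sum_(v in S) #|[set z | (interp v).[z] == b z]|%:R :> R.
  under eq_bigr => v _ do rewrite card_predE.
  rewrite exchange_big card_predE /=; apply: ler_sum => z _.
  case: ltP => [ltz|_]; last by apply: sumr_ge0 => v _; apply: ler0n.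
  have [v] : exists v, [&& v \in RS_at D d z (b z) & alpha < agree eta w v].
    apply/existsP; apply: contraLR ltz; rewrite negb_exists => /forallP noneV.
    rewrite -leNgt; apply/bigmax_leP; split=> // v vz.
    by have := noneV v; rewrite vz /= -leNgt.
  rewrite inE => /andP[/andP[vR vz] vagree].
  rewrite (bigD1 v) /=; last by rewrite inE vR.
  by rewrite vz lerDl; apply: sumr_ge0 => v' _; apply: ler0n.
(* A nonempty [E] forces a nonempty [S], which makes the termwise strict bound in [few] strict after
   summation. *)
have S0 : has (mem S) (index_enum (word F D)).
  apply: contraTT (lt_le_trans E0 cover) => /hasPn noS.
  by rewrite big1 ?ltxx // => v vS; have := noS v; rewrite mem_index_enum inE vS => /(_ isT).
have few : \sum_(v in S) #|[set z | (interp v).[z] == b z]|%:R < \sum_(v in S) tau.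
  apply: ltr_sum => // v vS; rewrite ltNge.
  by have /negbT := none v; rewrite inE [v \in S]vS.
have le_L : \sum_(v in S) tau <= L%:R * tau.
  by rewrite sumr_const -[leLHS]mulr_natl ler_wpM2r ?(ltW tau0) // ler_nat.
by have := lt_le_trans (le_lt_trans cover few) (le_trans le_L LE); rewrite ltxx.
Qed.

Lemma agree_set_ge_weight (R : realType) (F : finFieldType) (D : {set F})
    (D0 : D != set0)
    (eta : {y : F | y \in D} -> R) (eta0 : forall y, 0 <= eta y)
    (a : R) (u v : word F D) (W : {set word F D}) (C : {set {y : F | y \in D}}) :
    v \in W -> {in C, u =1 v} -> a * #|D|%:R <= \sum_(y in C) eta y ->
  a <= agree_set eta u W.
Proof.
move=> vW uv; have cD : 0 < #|D|%:R :> R by rewrite ltr0n card_gt0.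
rewrite -ler_pdivlMr // mulrC => /le_trans; apply.
apply: le_trans (agree_set_le eta u vW).
rewrite ler_pM2l ?invr_gt0 //.
rewrite big_mkcond [leRHS]big_mkcond /=; apply: ler_sum => i _.
by case: ifP => [/uv ->|_]; [rewrite eqxx | case: ifP].
Qed.

Lemma interp0 (F : finFieldType) (D : {set F}) : interp ([ffun=> 0] : word F D) = 0.
Proof. by rewrite /interp big1 // => i _; rewrite ffunE scale0r. Qed.

Lemma uniform_prob_pair (R : realType) (S T : finType) (P : pred (S * T)) :
    (0 < #|S|)%N -> (0 < #|T|)%N ->
  uniform_prob R P * (#|S|%:R * #|T|%:R) = \sum_x #|[set z | P (x, z)]|%:R.
Proof.
move=> S0 T0; rewrite /uniform_prob card_prod natrM divfK; last first.
  by rewrite mulf_neq0 // pnatr_eq0 -lt0n.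
rewrite -[#|P|]/(#|[pred p | P p]|) -cardsE card_predE.
under [RHS]eq_bigr => x _ do rewrite card_predE.
by rewrite pair_big; apply: eq_bigr => -[].
Qed.

Lemma card_agreeing_codewords (R : realType) (F : finFieldType) (D : {set F})
    (D0 : D != set0) (d : nat) (alpha : R)
    (eta : {y : F | y \in D} -> R) (eta1 : forall y, eta y <= 1) (w : word F D) :
  (#|[set v in RS D d | (alpha < agree eta w v)%R]| <= RS_list_size D d (1 - alpha))%N.
Proof.
apply: leq_trans (leq_bigmax w); apply: subset_leq_card; apply/subsetP => v.
by rewrite !inE => /andP[-> /hamming_lt -> //].
Qed.

(** * From the probability bound to a line of codewords *)

Theorem mainTheorem5 (R : realType) (F : finFieldType) (D : {set F})
    (D_neq0 : D != set0)
    (rho : R) (rho_gt0 : 0 < rho) (d : nat) (d_def : d%:R = rho * #|D|%:R)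
    (alpha : R) (alpha_lt1 : alpha < 1)
    (eta : {y : F | y \in D} -> R) (eta01 : forall y, 0 <= eta y <= 1)
    (eps : R) (eps_gt0 : 0 < eps)
    (u ustar : word F D)
    (B : F -> {poly F}) (B_linear : forall z, (size (B z) <= 2)%N)
    (Lstar : nat) (Lstar_def : Lstar = RS_list_size D d (1 - alpha))
    (agree_often :
      Num.max (2 * Lstar%:R * (d%:R / #|F|%:R + eps) `^ 3^-1)
              (4 / (eps ^+ 2 * #|F|%:R))
      <= uniform_prob R (fun xz : F * F =>
           alpha < agree_set eta [ffun y => ustar y + xz.1 * u y]
                             (RS_at D d xz.2 (B xz.2).[xz.1]))) :
  (exists v vstar : word F D, exists C : {set {y : F | y \in D}},
     [/\ v \in RS D d /\ vstar \in RS D d,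
         (alpha - eps) * #|D|%:R < \sum_(y in C) eta y,
         {in C, u =1 v}
       & {in C, ustar =1 vstar}])
  /\ (alpha - eps <= agree_set eta u (RS D d)
      /\ alpha - eps <= agree_set eta ustar (RS D d)).
Proof.
have eta0 y : 0 <= eta y by case/andP: (eta01 y).
have eta1 y : eta y <= 1 by case/andP: (eta01 y).
suff [v [vstar [C [vRS vsRS big_C uv usvs]]]] :
    exists v vstar : word F D, exists C : {set {y : F | y \in D}},
     [/\ v \in RS D d, vstar \in RS D d,
         (alpha - eps) * #|D|%:R < \sum_(y in C) eta y,
         {in C, u =1 v}
       & {in C, ustar =1 vstar}].
  split; first by exists v, vstar, C; split.
  by split; [apply: agree_set_ge_weight vRS uv (ltW big_C)
            |apply: agree_set_ge_weight vsRS usvs (ltW big_C)].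
have cD : 0 < #|D|%:R :> R by rewrite ltr0n card_gt0.
(* If [alpha < eps], the target weight is negative and the empty [C] suffices. Otherwise
   [0 < eps <= alpha < 1], as the pigeonhole and rich-pair steps require. *)
have [le_eps|lt_eps] := leP eps alpha; last first.
  exists [ffun=> 0], [ffun=> 0], set0; rewrite !inE interp0 size_poly0.
  split=> //; try by move=> y; rewrite inE.
  by rewrite big_set0 pmulr_llt0 // subr_lt0.
have F0 : (0 < #|F|)%N by apply/card_gt0P; exists 0.
set q : R := #|F|%:R in agree_often *.
have q0 : 0 < q by rewrite ltr0n.
set P : R := uniform_prob R _ in agree_often.
set t : R := _ `^ _ in agree_often.
have t3 : t ^+ 3 = d%:R / q + eps.
  rewrite /t -powR_mulrn ?powR_ge0 // -powRrM mulVf ?pnatr_eq0 // powRr1 //.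
  by rewrite addr_ge0 ?(ltW eps_gt0) // divr_ge0 // ltW.
have t0 : 0 < t.
  by rewrite powR_gt0 // ltr_wpDl ?divr_ge0 ?(ltW q0).
have [PL Pe] : 2 * Lstar%:R * t <= P /\ 4 / (eps ^+ 2 * q) <= P.
  by apply/andP; rewrite -ge_max.
have P0 : 0 < P by apply: lt_le_trans Pe; rewrite divr_gt0 // mulr_gt0 // exprn_gt0.
pose ux (x : F) : word F D := [ffun y => ustar y + x * u y].
pose n (x : F) : R :=
  #|[set z | alpha < agree_set eta (ux x) (RS_at D d z (B z).[x])]|%:R.
(* The [x] whose conditional probability over [z] is at least [P / 2]. By averaging they number at
   least [(P / 2) q], which the second term of the maximum bounds below by [2 / eps ^+ 2]. *)
pose A := [set x | P / 2 * q <= n x].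
have A_large : 2 / eps ^+ 2 <= #|A|%:R.
  have nq x : n x <= q by rewrite ler_nat max_card.
  have c0 : 0 <= P / 2 * q by rewrite mulr_ge0 ?(ltW q0) // divr_ge0 // ltW.
  have := sum_le_threshold nq c0.
  rewrite -(uniform_prob_pair R (fun xz : F * F =>
    alpha < agree_set eta (ux xz.1) (RS_at D d xz.2 (B xz.2).[xz.1]))) //.
  rewrite -/P -/q -/A => sumP.
  have half : P / 2 * q <= #|A|%:R.
    rewrite -(ler_pM2l q0); move: sumP.
    have -> : P * (q * q) = q * (P / 2 * q) + P / 2 * q * q by field.
    by rewrite lerD2r.
  apply: le_trans half; rewrite -ler_pdivrMr // ler_pdivlMr //; apply: le_trans Pe.
  by rewrite le_eqVlt; apply/orP; left; apply/eqP; field; rewrite !gt_eqF.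
have /fin_all_exists[vx vxP] : forall x, exists v : word F D, x \in A ->
    [/\ v \in RS D d, alpha < agree eta (ux x) v
      & t * q <= #|[set z | (interp v).[z] == (B z).[x]]|%:R].
  move=> x; have [xA|] := boolP (x \in A); last by exists [ffun=> 0].
  have nx : P / 2 * q <= n x by move: xA; rewrite inE.
  have [|||||v vP] := @exists_popular_codeword R F D d alpha _ eta (ux x)
    (fun z => (B z).[x]) Lstar (t * q) _ _ _ _; last by exists v.
  - by rewrite (le_trans _ le_eps) // ltW.
  - by rewrite Lstar_def card_agreeing_codewords.
  - by rewrite mulr_gt0.
  - by apply: lt_le_trans nx; rewrite mulr_gt0 // divr_gt0.
  (* The first term of the maximum gives [Lstar * t <= P / 2]; its factor 2 pays for the
     averaging. *)
  - apply: le_trans nx; rewrite mulrA ler_pM2r // ler_pdivlMr //.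
    by apply: le_trans PL; rewrite mulrC mulrA.
pose h x z := (interp (vx x)).[z] == (B z).[x].
pose collinear x y w := [forall i,
  (y - w) * vx x i + (w - x) * vx y i + (x - y) * vx w i == 0].
have [] := @exists_rich_pair R F F A h collinear d t eps (ltW t0) _ F0 _ A_large _ _.
- by rewrite eps_gt0 (le_lt_trans le_eps).
- by rewrite t3 mulrDl divfK ?gt_eqF.
- by move=> x /vxP[].
- move=> x y w /vxP[xR _ _] /vxP[yR _ _] /vxP[wR _ _] dle.
  by apply/forallP => i; apply/eqP; apply: (collinear_codewords B_linear xR yR wR dle).
move=> x [y [xA yA nxy]]; set A' := [set w in A | _] => A'_large.
have [[xR _ _] [yR _ _]] := (vxP _ xA, vxP _ yA).
have xy0 : x - y != 0 by rewrite subr_eq0.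
(* Slope [v] and intercept [vs] of the line through [(x, vx x)] and [(y, vx y)]. *)
pose v : word F D := [ffun i => (x - y)^-1 * vx x i + - (x - y)^-1 * vx y i].
pose vs : word F D := [ffun i => - (y / (x - y)) * vx x i + x / (x - y) * vx y i].
exists v, vs, [set i | (u i == v i) && (ustar i == vs i)]; split.
- exact: RS_linear.
- exact: RS_linear.
- apply: (weight_common_agreement D_neq0 eta01 eps_gt0 A'_large) => w.
  rewrite inE => /andP[wA /forallP wcol].
  have [_ wagree _] := vxP _ wA.
  (* Collinearity puts [vx w] on this line, so the agreement known for [vx w] passes to
     [vs + w v]. *)
  suff <- : vx w = [ffun i => vs i + w * v i] by [].
  apply/ffunP => i; rewrite !ffunE; apply: (mulfI xy0).
  transitivity ((w - y) * vx x i + (x - w) * vx y i); last by field.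
  by apply/eqP; rewrite -subr_eq0 -(eqP (wcol i)); apply/eqP; ring.
- by move=> i; rewrite inE => /andP[/eqP].
- by move=> i; rewrite inE => /andP[_ /eqP].
Qed.
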